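(* Let $(B,\cdot,\circ)$ be a left semi-brace. The following conditions are equivalent: (1) $\rho:(B,\circ)\to\mathrm{Map}(B,B)$ is an anti-homomorphism; (2) $1_{\circ}B1_{\circ}$, $E(B1_{\circ})$ and $E(1_{\circ}B)$ are left subsemi-braces of $B$ with $B\cong(1_{\circ}B1_{\circ}\bowtie E(B1_{\circ}))\bowtie E(1_{\circ}B)$ as left semi-braces (for suitable matched products), and $E(B)$ is a left subsemi-brace of $B$.
   Context: A left semi-brace is a set $B$ with two operations $\cdot$ and $\circ$ such that $(B,\cdot)$ is a semigroup, $(B,\circ)$ is a group, and $a\circ(bc)=(a\circ b)(a\circ(\overline{a}c))$ for all $a,b,c\in B$ (here $xy$ means $x\cdot y$ and $\overline{a}$ is the inverse of $a$ in $(B,\circ)$). The identity of $(B,\circ)$ is $1_{\circ}$. $1_{\circ}B=\{1_{\circ}b\mid b\in B\}$, $B1_{\circ}=\{b1_{\circ}\mid b\in B\}$, $1_{\circ}B1_{\circ}=\{1_{\circ}b1_{\circ}\mid b\in B\}$. $E(S)$ denotes the set of idempotents of $S$ with respect to $\cdot$. A left subsemi-brace is a subset that is a subsemigroup of $(B,\cdot)$ and a subgroup of $(B,\circ)$. The $\rho$-map: $\rho_a:B\to B$, $\rho_a(b)=\overline{(\overline{b}a)}\circ a$; $\rho:a\mapsto\rho_a$ is an anti-homomorphism if $\rho_{a\circ b}=\rho_b\rho_a$ (composition of maps) for all $a,b\in B$. Matched product: let $(A,\cdot,\circ)$ and $(S,\cdot,\circ)$ be left semi-braces, $\delta:A\to\mathrm{Sym}(S)$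 a right action of the group $(A,\circ)$ on the set $S$ (so $\delta_a\delta_b=\delta_{b\circ a}$), and $\sigma:S\to\mathrm{Aut}(A,\cdot)$ a left action of the group $(S,\circ)$ (so $\sigma_x\sigma_y=\sigma_{x\circ y}$), such that for all $x,y\in S$, $a,b\in A$: (i) $\sigma_x(a\circ b)=\sigma_x(a)\circ\sigma_{\delta_a(x)}(b)$; (ii) $\sigma_x(1_{\circ})=1_{\circ}$; (iii) $\delta_a(x\circ y)=\delta_{\sigma_y(a)}(x)\circ\delta_a(y)$; (iv) $\delta_a(1_{\circ})=1_{\circ}$; (v) $\overline{\delta_a(\overline{xy})}=\overline{\delta_a(\overline{x})}\;\overline{\delta_a(\overline{y})}$. The matched product $A\bowtie S$ (by $\delta$ and $\sigma$) is the left semi-brace on $A\times S$ with $(a,x)(b,y)=(ab,xy)$ and $(a,x)\circ(b,y)=\left(a\circ\sigma_{\overline{\delta_a(\overline{x})}}(b),\ x\circ\overline{\delta_{\overline{\sigma_{\overline{x}}(a)}}(\overline{y})}\right)$. *)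

(* Defs.v *)
From HB Require Import structures.
From mathcomp Require Import all_boot.
From mathcomp Require Import boolp classical_sets.

Set Implicit Arguments.
Unset Strict Implicit.
Unset Printing Implicit Defensive.

Declare Scope semibrace_scope.
Delimit Scope semibrace_scope with SB.
Local Open Scope group_scope.
Local Open Scope classical_set_scope.
Local Open Scope semibrace_scope.

(* In a left semi-brace, the ambient groupType structure (1, ∘, ^-1) is the
   group (B, ∘), so that _^-1 is always the ∘-inverse, while ⋅ is the
   semigroup operation. *)
Reserved Notation "x ∘ y" (at level 40, left associativity).
Reserved Notation "x ⋅ y" (at level 40, left associativity).
Notation "1" := (1%g) : semibrace_scope.
Notation "x ∘ y" := (x * y)%g : semibrace_scope.

HB.mixin Record Group_isLeftSemiBrace B of Group B := {
  dot : B -> B -> B;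
  dotA : associative dot;
  circ_dot : forall a b c : B, a ∘ dot b c = dot (a ∘ b) (a ∘ dot a^-1 c)
}.

#[short(type="leftSemiBraceType")]
HB.structure Definition LeftSemiBrace :=
  {B of Group B & Group_isLeftSemiBrace B}.

Notation "x ⋅ y" := (dot x y) : semibrace_scope.

Definition isomorphic (A B : leftSemiBraceType) : Prop :=
  exists f : A -> B, [/\ bijective f,
    {morph f : a b / a ⋅ b} & {morph f : a b / a ∘ b}].

Section Subsets.
Variable B : leftSemiBraceType.

Definition one_dot_B : set B := [set 1 ⋅ b | b in [set: B]].
Definition B_dot_one : set B := [set b ⋅ 1 | b in [set: B]].
Definition one_dot_B_dot_one : set B := [set 1 ⋅ b ⋅ 1 | b in [set: B]].

Definition idempotents (A : set B) : set B := [set e | A e /\ e ⋅ e = e].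

Record left_subsemibrace (A : set B) : Prop := {
  subsemibrace_dot : {in A &, forall a b, a ⋅ b \in A};
  subsemibrace_group : group_closed [in A]
}.

Definition rho (a b : B) : B := (b^-1 ⋅ a)^-1 ∘ a.

Definition rho_antihom : Prop := forall a b : B, rho (a ∘ b) = rho b \o rho a.

End Subsets.

Arguments one_dot_B : clear implicits.
Arguments B_dot_one : clear implicits.
Arguments one_dot_B_dot_one : clear implicits.
Arguments rho_antihom : clear implicits.

Record subsemibrace (B : leftSemiBraceType) (A : set B)
  (hA : left_subsemibrace A) : Type :=
  SubSemiBrace { subsemibrace_val :> B; _ : subsemibrace_val \in A }.

Section Subsemibrace.
Variables (B : leftSemiBraceType) (A : set B) (hA : left_subsemibrace A).

HB.instance Definition _ :=
  [isSub of subsemibrace hA for @subsemibrace_val B A hA].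
HB.instance Definition _ := [Choice of subsemibrace hA by <:].
HB.instance Definition _ :=
  SubChoice_isSubGroup.Build B [in A] (subsemibrace hA) (subsemibrace_group hA).

Definition sub_dot (x y : subsemibrace hA) : subsemibrace hA :=
  SubSemiBrace hA (subsemibrace_dot hA (valP x) (valP y)).

Lemma sub_dotA : associative sub_dot.
Proof. by move=> x y z; apply: val_inj; rewrite /= dotA. Qed.

Lemma sub_circ_dot (a b c : subsemibrace hA) :
  a ∘ sub_dot b c = sub_dot (a ∘ b) (a ∘ sub_dot a^-1 c).
Proof. by apply: val_inj; rewrite /= circ_dot. Qed.

HB.instance Definition _ :=
  Group_isLeftSemiBrace.Build (subsemibrace hA) sub_dotA sub_circ_dot.

End Subsemibrace.

(* The data from which a matched product A ⋈ S is built: delta is a right action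
   of (A, ∘) on the set S by bijections, and sigma a left action of (S, ∘) on A
   by automorphisms of (A, ⋅). *)
Record matched_pair (A S : leftSemiBraceType) := MatchedPair {
  delta : A -> S -> S;
  sigma : S -> A -> A;
  delta_bij : forall a, bijective (delta a);
  delta_act : forall a b, delta a \o delta b = delta (b ∘ a);
  sigma_bij : forall x, bijective (sigma x);
  sigma_dot : forall x, {morph sigma x : a b / a ⋅ b};
  sigma_act : forall x y, sigma x \o sigma y = sigma (x ∘ y);
  sigma_circ : forall x a b,
    sigma x (a ∘ b) = sigma x a ∘ sigma (delta a x) b;
  sigma1 : forall x, sigma x 1 = 1;
  delta_circ : forall a x y,
    delta a (x ∘ y) = delta (sigma y a) x ∘ delta a y;
  delta1 : forall a, delta a 1 = 1;
  delta_dot : forall a x y,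
    (delta a (x ⋅ y)^-1)^-1 = (delta a x^-1)^-1 ⋅ (delta a y^-1)^-1
}.

Definition matched_product (A S : leftSemiBraceType) (m : matched_pair A S)
  : Type := (A * S)%type.

Section MatchedProduct.
Variables (A S : leftSemiBraceType) (m : matched_pair A S).
Local Notation P := (matched_product m).
Local Notation δ := (delta m).
Local Notation σ := (sigma m).

Definition mp_dot (p q : P) : P := (p.1 ⋅ q.1, p.2 ⋅ q.2).

Definition mp_circ (p q : P) : P :=
  let: (a, x) := p in let: (b, y) := q in
  (a ∘ σ (δ a x^-1)^-1 b, x ∘ (δ (σ x^-1 a)^-1 y^-1)^-1).

Definition mp_one : P := (1, 1).

Definition mp_inv (p : P) : P :=
  let: (a, x) := p in ((σ x^-1 a)^-1, δ a x^-1).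

Let δM a b x : δ a (δ b x) = δ (b ∘ a) x.
Proof. by rewrite -(delta_act m). Qed.

Let σM x y a : σ x (σ y a) = σ (x ∘ y) a.
Proof. by rewrite -(sigma_act m). Qed.

Let δ_id x : δ 1 x = x.
Proof.
have [g gK _] := delta_bij m 1.
by apply: (can_inj gK); rewrite δM mulg1.
Qed.

Let σ_id a : σ 1 a = a.
Proof.
have [g gK _] := sigma_bij m 1.
by apply: (can_inj gK); rewrite σM mulg1.
Qed.

Let σV x a : σ x a^-1 = (σ (δ a^-1 x) a)^-1.
Proof.
by apply: (mulIg (σ (δ a^-1 x) a)); rewrite -(sigma_circ m) !mulVg sigma1.
Qed.

Let δV a x : δ a x^-1 = (δ (σ x^-1 a) x)^-1.
Proof.
by apply: (mulgI (δ (σ x^-1 a) x)); rewrite -(delta_circ m) !mulgV delta1.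
Qed.

(* (a, x) encodes the element a s = x c of the Zappa-Szep group in which
   y b = σ_y(b) δ_b(y); here s = zsr a x, c = zsl a x. *)
Let zsr a x := (δ a x^-1)^-1.
Let zsl a x := σ x^-1 a.

Let zslE a x : δ (zsl a x) x = zsr a x.
Proof. by rewrite /zsr δV invgK. Qed.

Let zsVr a x : δ (zsl a x)^-1 (zsr a x) = x.
Proof. by rewrite -zslE δM mulgV δ_id. Qed.

Let zsVl a x : σ (zsr a x) (zsl a x)^-1 = a^-1.
Proof. by rewrite σV zsVr /zsl σM mulgV σ_id. Qed.

Let zsrV a x : zsr (zsl a x)^-1 (zsr a x)^-1 = x^-1.
Proof. by rewrite {1}/zsr invgK zsVr. Qed.

Let zsr_dot a x y : zsr a (x ⋅ y) = zsr a x ⋅ zsr a y.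
Proof. exact: delta_dot. Qed.

Let zsr_circ a x b y :
  zsr (a ∘ σ (zsr a x) b) (x ∘ zsr (zsl a x)^-1 y) = δ b (zsr a x) ∘ zsr b y.
Proof.
rewrite {1}/zsr invgM -δM delta_circ -/(zsl a x) -/(zsr _ _).
rewrite [in X in δ _ (δ _ X ∘ _)]/zsr invgK δM mulVg δ_id.
rewrite -[δ a x^-1]invgK -/(zsr a x) delta_circ !σM mulVg σ_id.
by rewrite [δ _ (zsr a x)^-1]δV invgM σM mulVg σ_id !invgK.
Qed.

Let zsl_circ a x b y :
  zsl (a ∘ σ (zsr a x) b) (x ∘ zsr (zsl a x)^-1 y) =
  (σ y^-1 (zsl a x)^-1)^-1 ∘ zsl b y.
Proof.
rewrite {1}/zsl invgM -σM sigma_circ -/(zsl a x).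
rewrite -[δ a x^-1]invgK -/(zsr a x) σM mulVg σ_id sigma_circ.
by rewrite /zsr invgK δM mulVg δ_id σV invgK.
Qed.

Let mp_circE a x b y :
  mp_circ (a, x) (b, y) =
  (a ∘ σ (zsr a x) b, x ∘ zsr (zsl a x)^-1 y) :> P.
Proof. by []. Qed.

Let mp_invE a x : mp_inv (a, x) = ((zsl a x)^-1, (zsr a x)^-1) :> P.
Proof. by rewrite /zsr invgK. Qed.

Lemma mp_circA : associative mp_circ.
Proof.
move=> [a x] [b y] [c z]; rewrite !mp_circE zsr_circ zsl_circ sigma_circ σM.
rewrite !mulgA -!(mulgA x); congr (_, x ∘ _).
by rewrite /zsr !invgM !invgK delta_circ invgM δM.
Qed.

Lemma mp_circ1p : left_id mp_one mp_circ.
Proof.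
move=> [a x]; rewrite mp_circE /zsr /zsl sigma1 !invg1 delta1 invg1.
by rewrite δ_id σ_id !mul1g invgK.
Qed.

Lemma mp_circp1 : right_id mp_one mp_circ.
Proof.
by move=> [a x]; rewrite mp_circE /zsr invg1 sigma1 delta1 invg1 !mulg1.
Qed.

Lemma mp_circVp : left_inverse mp_one mp_inv mp_circ.
Proof.
move=> [a x]; rewrite mp_invE mp_circE zsrV.
have -> : zsl (zsl a x)^-1 (zsr a x)^-1 = a^-1 by rewrite {1}/zsl invgK zsVl.
by rewrite !invgK -/(zsl a x) /zsr mulgV mulVg.
Qed.

Lemma mp_circpV : right_inverse mp_one mp_inv mp_circ.
Proof.
move=> [a x]; rewrite mp_invE mp_circE zsVl zsrV.
by rewrite !mulgV.
Qed.

HB.instance Definition _ := Choice.copy (matched_product m) (A * S)%type.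
HB.instance Definition _ :=
  isGroup.Build (matched_product m) mp_circA mp_circ1p mp_circp1 mp_circVp mp_circpV.

Lemma mp_dotA : associative mp_dot.
Proof. by move=> p q r; rewrite /mp_dot /= !dotA. Qed.

Lemma mp_circ_dot (p q r : P) :
  p ∘ mp_dot q r = mp_dot (p ∘ q) (p ∘ mp_dot p^-1 r).
Proof.
have circE (u v : P) : u ∘ v = mp_circ u v by [].
have invE (u : P) : u^-1 = mp_inv u by [].
rewrite !circE invE; case: p q r => [a x] [b y] [c z].
rewrite mp_invE /mp_dot !mp_circE /= !sigma_dot zsVl !zsr_dot zsrV.
by rewrite -!circ_dot.
Qed.

HB.instance Definition _ := Group_isLeftSemiBrace.Build (matched_product m) mp_dotA mp_circ_dot.

End MatchedProduct.

(* Main.v *)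
Require Import Defs.
From HB Require Import structures.
From mathcomp Require Import all_boot.
From mathcomp Require Import boolp classical_sets.

Set Implicit Arguments.
Unset Strict Implicit.
Unset Printing Implicit Defensive.

Local Open Scope group_scope.
Local Open Scope classical_set_scope.
Local Open Scope semibrace_scope.

(** Put [lambda a b = a ∘ (a^-1 ⋅ b)].  This is an action of (B, ∘) on B by
    endomorphisms of (B, ⋅), except that [lambda 1] is only a projection, onto
    1B; and it determines ⋅, since [a ⋅ b = a ∘ lambda a^-1 b].  It follows that
    1 is idempotent, hence that the orbit map [orbit1 a = lambda a 1] is a
    retraction onto E(1B) and that B1 is the stabilizer of 1 ([orbit1_id],
    [idempotents_one_dot_BP], [B_dot_oneP]).

    Rewriting [rho] with [lambda] turns the anti-homomorphism identity into
    [1 ⋅ (a ∘ b) = 1 ⋅ (a ∘ (1 ⋅ b))], that is, into the statement that the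
    kernel of the projection [b |-> 1 ⋅ b] is stable under left translations of
    (B, ∘) ([rho_antihomE]).

    This identity passes to matched products and isomorphic copies
    ([matched_product_one_compatible]).  It is trivial on 1B1 and E(1B), where
    1 ⋅ b = b, and on E(B1), where 1 ⋅ b = 1; so the decomposition implies it.

    Conversely, the identity makes K = {k | 1 ⋅ k = 1} a subgroup and 1B a
    complement of K, while E(1B) is a transversal of the left cosets of B1, and
    is now a subgroup.  Intersecting, B1 is the exact product of 1B1 and
    E(B1) = B1 ∩ K, with projection [h |-> 1 ⋅ h] onto 1B1, and B is the exact
    product of B1 and E(1B), with projections [b |-> b ⋅ 1] and [orbit1].  All these projections
    are multiplicative for ⋅, which together with the identity is what makes
    the two actions of an exact factorization of groups into matched-product
    data ([internal_matched_product]).  Finally an element of E(B) is the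
    ∘-product of one in E(1B) and one in E(B1), so that E(B) is stable under
    inverses. *)

(** * The lambda-action and the orbit of 1 *)

Section Lambda.
Variable B : leftSemiBraceType.
Implicit Types a b c : B.

Definition lambda a b : B := a ∘ (a^-1 ⋅ b).
Definition orbit1 a : B := lambda a 1.

Lemma circ_dotE a b c : a ∘ (b ⋅ c) = (a ∘ b) ⋅ lambda a c.
Proof. exact: circ_dot. Qed.

Lemma lambda_dot a : {morph lambda a : b c / b ⋅ c}.
Proof. by move=> b c; rewrite /lambda dotA circ_dotE. Qed.

Lemma lambda_circ a b c : lambda (a ∘ b) c = lambda a (lambda b c).
Proof.
rewrite /lambda -mulgA; congr (a ∘ _); rewrite invgM.
by rewrite (circ_dotE b (b^-1 ∘ a^-1)) mulVKg.
Qed.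

Lemma lambda1E b : lambda 1 b = 1 ⋅ b.
Proof. by rewrite /lambda mul1g invg1. Qed.

Lemma dot_circE a b : a ⋅ b = a ∘ lambda a^-1 b.
Proof. by rewrite /lambda invgK mulVKg. Qed.

Lemma one_lambda a b : 1 ⋅ lambda a b = lambda a b.
Proof. by rewrite -lambda1E -lambda_circ mul1g. Qed.

Lemma lambda_one a b : lambda a (1 ⋅ b) = lambda a b.
Proof. by rewrite -lambda1E -lambda_circ mulg1. Qed.

Lemma lambdaKV a b : lambda a^-1 (lambda a b) = 1 ⋅ b.
Proof. by rewrite -lambda_circ mulVg lambda1E. Qed.

Lemma dot_lambda a b : a ⋅ lambda a b = a ∘ (1 ⋅ b).
Proof. by rewrite dot_circE lambdaKV. Qed.

Lemma dot_one_dot a b : a ⋅ (1 ⋅ b) = a ⋅ b.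
Proof. by rewrite !(dot_circE a) lambda_one. Qed.

(** With e = 1 ⋅ 1, idempotency of e reads [lambda e^-1 e = 1], so 1 lies in the
    image 1B of [lambda], which left multiplication by 1 fixes. *)
Lemma one_dot_one : 1 ⋅ 1 = 1 :> B.
Proof.
set e := 1 ⋅ 1.
have ee : e ⋅ e = e by rewrite /e dot_one_dot -dotA dot_one_dot.
have e1 : lambda e^-1 e = 1.
  by apply: (mulgI e); rewrite -dot_circE mulg1.
by rewrite /e -{2}e1 one_lambda.
Qed.

Lemma orbit1_circ a b : orbit1 (a ∘ b) = lambda a (orbit1 b).
Proof. exact: lambda_circ. Qed.

Lemma orbit1_1 : orbit1 1 = 1.
Proof. by rewrite /orbit1 lambda1E one_dot_one. Qed.

Lemma one_orbit1 a : 1 ⋅ orbit1 a = orbit1 a.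
Proof. exact: one_lambda. Qed.

Lemma orbit1V a : (orbit1 a^-1 = 1) <-> (orbit1 a = 1).
Proof.
suff h b : orbit1 b = 1 -> orbit1 b^-1 = 1 by split=> /h //; rewrite invgK.
by move=> b1; rewrite /orbit1 -{1}b1 lambdaKV one_dot_one.
Qed.

(** Since [b ⋅ lambda b 1 = b], the element x = [lambda a b] is fixed by right
    ⋅-multiplication by [orbit1 (a ∘ b)], which means that [lambda x^-1] sends
    [orbit1 (a ∘ b)] to 1. *)
Lemma orbit1_lambda a b : orbit1 (lambda a b) = orbit1 (a ∘ b).
Proof.
have : lambda a b ⋅ orbit1 (a ∘ b) = lambda a b.
  by rewrite orbit1_circ -lambda_dot dot_lambda one_dot_one mulg1.
rewrite dot_circE -orbit1_circ -[RHS]mulg1 => /mulgI.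
by rewrite orbit1_circ => h; rewrite {1}/orbit1 -h -lambda_circ mulgV lambda1E
  one_orbit1.
Qed.

Lemma orbit1_dot a b : orbit1 (a ⋅ b) = orbit1 b.
Proof.
by rewrite dot_circE orbit1_circ orbit1_lambda -orbit1_circ mulVKg.
Qed.

Lemma orbit1_id a : orbit1 (orbit1 a) = orbit1 a.
Proof. by rewrite {2}/orbit1 orbit1_lambda mulg1. Qed.

Lemma dot1E a : a ⋅ 1 = a ∘ orbit1 a^-1.
Proof. exact: dot_circE. Qed.

Lemma dot1_fixed a : (a ⋅ 1 = a) <-> (orbit1 a = 1).
Proof.
rewrite dot1E -orbit1V; split=> [|->]; last by rewrite mulg1.
by rewrite -[RHS]mulg1 => /mulgI.
Qed.

Lemma idempotentE a : (a ⋅ a = a) <-> (orbit1 a = 1 ⋅ a).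
Proof.
rewrite dot_circE; split=> [|aE].
  rewrite -[RHS]mulg1 => /mulgI h.
  by rewrite /orbit1 -{1}h -lambda_circ mulgV lambda1E.
by rewrite -lambda_one -aE lambdaKV one_dot_one mulg1.
Qed.

(** The element [orbit1 a ⋅ 1] is an idempotent of the monoid 1B1, and there
    [idempotentE] leaves only 1, since [orbit1] is 1 on B1. *)
Lemma orbit1_dot1 a : orbit1 a ⋅ 1 = 1.
Proof.
set e := orbit1 a.
have ee : e ⋅ e = e by apply/idempotentE; rewrite orbit1_id one_orbit1.
have : (e ⋅ 1) ⋅ (e ⋅ 1) = e ⋅ 1.
  by rewrite dotA -(dotA e 1 e) dot_one_dot ee.
by move/idempotentE; rewrite orbit1_dot orbit1_1 dotA one_orbit1.
Qed.

Lemma orbit1_dotl a b : orbit1 a ⋅ b = 1 ⋅ b.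
Proof. by rewrite -dot_one_dot dotA orbit1_dot1. Qed.

Lemma B_dot_oneP a : B_dot_one B a <-> orbit1 a = 1.
Proof.
split=> [[b _ <-]|/dot1_fixed a1]; first by rewrite orbit1_dot orbit1_1.
by exists a.
Qed.

Lemma one_dot_BP a : one_dot_B B a <-> 1 ⋅ a = a.
Proof.
split=> [[b _ <-]|a1]; first by rewrite dot_one_dot.
by exists a.
Qed.

Lemma one_dot_B_dot_oneP a :
  one_dot_B_dot_one B a <-> 1 ⋅ a = a /\ orbit1 a = 1.
Proof.
split=> [[b _ <-]|[a1 /dot1_fixed a2]].
  by rewrite orbit1_dot orbit1_1 -dotA dot_one_dot.
by exists a => //; rewrite a1 a2.
Qed.

Lemma idempotents_B_dot_oneP a :
  idempotents (B_dot_one B) a <-> orbit1 a = 1 /\ 1 ⋅ a = 1.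
Proof.
split=> [[/B_dot_oneP a1 /idempotentE]|[a1 a2]].
  by rewrite a1 => <-.
by split; [apply/B_dot_oneP|apply/idempotentE; rewrite a1 a2].
Qed.

Lemma idempotents_one_dot_BP a :
  idempotents (one_dot_B B) a <-> orbit1 a = a.
Proof.
split=> [[/one_dot_BP a1 /idempotentE ->//]|a1].
have a2 : 1 ⋅ a = a by rewrite -a1 one_orbit1.
by split; [apply/one_dot_BP|apply/idempotentE; rewrite a1 a2].
Qed.

Lemma idempotentsP a : idempotents [set: B] a <-> orbit1 a = 1 ⋅ a.
Proof. by split=> [[_ /idempotentE]|/idempotentE]. Qed.

End Lambda.

(** * The rho-map and the kernel of left multiplication by 1 *)

(** For fixed a, the class of [a ∘ b] modulo the kernel of [b |-> 1 ⋅ b] depends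
    only on the class of b; equivalently, that kernel is a left congruence of
    (B, ∘). *)
Definition one_compatible (B : leftSemiBraceType) :=
  forall a b : B, 1 ⋅ (a ∘ b) = 1 ⋅ (a ∘ (1 ⋅ b)).

(** Since [rho a b = (lambda b a)^-1 ∘ b ∘ a], the value [rho b (rho a c)] is that
    of [rho (a ∘ b) c] with [lambda c (a ∘ b)] replaced by
    [lambda c (a ∘ (1 ⋅ b))]; and [lambda c] has the same kernel as
    [lambda 1]. *)
Lemma rho_antihomE (B : leftSemiBraceType) :
  rho_antihom B <-> one_compatible B.
Proof.
have rhoE (a b : B) : rho a b = (lambda b a)^-1 ∘ b ∘ a.
  by rewrite /rho dot_circE invgK invgM invgK.
have rhoM (a b c : B) :
    rho b (rho a c) = (lambda c (a ∘ (1 ⋅ b)))^-1 ∘ c ∘ (a ∘ b).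
  rewrite rhoE [rho a c]rhoE !lambda_circ -dot_lambda lambda_dot.
  by rewrite dot_circE [in RHS]invgM !mulgA.
split=> [h a b|h a b].
  have := congr1 (@^~ 1) (h a b); rewrite /= rhoM rhoE => /mulIg/mulIg/invg_inj.
  by rewrite !lambda1E.
apply/funext => c; rewrite /= rhoM rhoE.
by rewrite -lambda_one h lambda_one.
Qed.

Lemma isomorphic_one_compatible (A B : leftSemiBraceType) :
  isomorphic B A -> one_compatible A -> one_compatible B.
Proof.
move=> [f [fbij fD fM]] hA a b.
have f1 : f 1 = 1 by apply: (mulgI (f 1)); rewrite -fM !mulg1.
by apply: (bij_inj fbij); rewrite !(fD, fM, f1) hA.
Qed.

(** Each component of [p ∘ q] has the form [a ∘ f b], where f is an
    automorphism given by [sigma] or a map [y |-> (delta c y^-1)^-1].  Such an f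
    depends on p only, is multiplicative for ⋅ and fixes 1; hence f commutes with left multiplication by 1. *)
Lemma matched_product_one_compatible (A S : leftSemiBraceType)
    (m : matched_pair A S) :
  one_compatible A -> one_compatible S -> one_compatible (matched_product m).
Proof.
move=> hA hS [a x] [b y].
have -> : (1 : matched_product m) ⋅ (b, y) = (1 ⋅ b, 1 ⋅ y) by [].
set s := (delta m a x^-1)^-1; set c := (sigma m x^-1 a)^-1.
have circE d z : ((a, x) : matched_product m) ∘ (d, z) =
  (a ∘ sigma m s d, x ∘ (delta m c z^-1)^-1) by [].
rewrite !circE /dot /= /mp_dot /=; congr (_, _).
  by rewrite sigma_dot sigma1 hA.
by rewrite delta_dot invg1 delta1 invg1 hS.
Qed.

(** * Matched products from exact factorizations *)

Section Internal.
Variables (A S B : leftSemiBraceType) (i : A -> B) (j : S -> B).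
Variables (alpha : B -> A) (beta : B -> S).
Hypotheses (iM : {morph i : a b / a ∘ b}) (iD : {morph i : a b / a ⋅ b}).
Hypotheses (jM : {morph j : x y / x ∘ y}) (jD : {morph j : x y / x ⋅ y}).
Hypothesis factor : forall b, b = i (alpha b) ∘ j (beta b).
Hypothesis alphaK : forall a x, alpha (i a ∘ j x) = a.
Hypothesis betaK : forall a x, beta (i a ∘ j x) = x.
(* [factor] writes b with its factor in A first; applied to b^-1 it gives the
   factorization b = j (xi b) ∘ i _ with the factor in S first. *)
Let xi b := (beta b^-1)^-1.
Hypothesis alphaD : {morph alpha : b c / b ⋅ c}.
Hypothesis xiD : {morph xi : b c / b ⋅ c}.
Hypothesis compat : one_compatible B.

Let i1 : i 1 = 1.
Proof. by apply: (mulgI (i 1)); rewrite -iM !mulg1. Qed.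
Let j1 : j 1 = 1.
Proof. by apply: (mulgI (j 1)); rewrite -jM !mulg1. Qed.
Let iV a : i a^-1 = (i a)^-1.
Proof. by apply: (mulgI (i a)); rewrite -iM !mulgV. Qed.
Let jV x : j x^-1 = (j x)^-1.
Proof. by apply: (mulgI (j x)); rewrite -jM !mulgV. Qed.
Let alpha_l a b : alpha (i a ∘ b) = a ∘ alpha b.
Proof. by rewrite {1}(factor b) mulgA -iM alphaK. Qed.
Let beta_l a b : beta (i a ∘ b) = beta b.
Proof. by rewrite {1}(factor b) mulgA -iM betaK. Qed.
Let alpha_r b x : alpha (b ∘ j x) = alpha b.
Proof. by rewrite {1}(factor b) -mulgA -jM alphaK. Qed.
Let beta_r b x : beta (b ∘ j x) = beta b ∘ x.
Proof. by rewrite {1}(factor b) -mulgA -jM betaK. Qed.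
Let alphai a : alpha (i a) = a.
Proof. by rewrite -[i a]mulg1 -j1 alphaK. Qed.
Let betai a : beta (i a) = 1.
Proof. by rewrite -[i a]mulg1 -j1 betaK. Qed.
Let alphaj x : alpha (j x) = 1.
Proof. by rewrite -[j x]mul1g -i1 alphaK. Qed.
Let betaj x : beta (j x) = x.
Proof. by rewrite -[j x]mul1g -i1 betaK. Qed.

(* The two actions are read off j x ∘ i a = i (sg x a) ∘ j (dl a x). *)
Let dl a x := beta (j x ∘ i a).
Let sg x a := alpha (j x ∘ i a).

Let swap x a : j x ∘ i a = i (sg x a) ∘ j (dl a x).
Proof. exact: factor. Qed.

Let dl_act a b : dl a \o dl b = dl (b ∘ a).
Proof.
by apply/funext => x; rewrite /= /dl iM mulgA {2}(factor (j x ∘ i b)) -mulgA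
  beta_l.
Qed.

Let sg_act x y : sg x \o sg y = sg (x ∘ y).
Proof.
by apply/funext => a; rewrite /= /sg jM -mulgA {2}(factor (j y ∘ i a)) mulgA
  alpha_r.
Qed.

Let dl_bij a : bijective (dl a).
Proof.
have dl1 x : dl 1 x = x by rewrite /dl i1 mulg1 betaj.
exists (dl a^-1) => x.
  by have := congr1 (@^~ x) (dl_act a^-1 a); rewrite /= mulgV dl1.
by have := congr1 (@^~ x) (dl_act a a^-1); rewrite /= mulVg dl1.
Qed.

Let sg_bij x : bijective (sg x).
Proof.
have sg1 a : sg 1 a = a by rewrite /sg j1 mul1g alphai.
exists (sg x^-1) => a.
  by have := congr1 (@^~ a) (sg_act x^-1 x); rewrite /= mulVg sg1.
by have := congr1 (@^~ a) (sg_act x x^-1); rewrite /= mulgV sg1.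
Qed.

Let sg_circ x a b : sg x (a ∘ b) = sg x a ∘ sg (dl a x) b.
Proof. by rewrite {1}/sg iM mulgA swap -mulgA alpha_l. Qed.

Let dl_circ a x y : dl a (x ∘ y) = dl (sg y a) x ∘ dl a y.
Proof. by rewrite {1}/dl jM -mulgA swap mulgA beta_r. Qed.

Let sg1 x : sg x 1 = 1.
Proof. by rewrite /sg i1 mulg1 alphaj. Qed.

Let dl1 a : dl a 1 = 1.
Proof. by rewrite /dl j1 mul1g betai. Qed.

Let alpha1 : alpha 1 = 1.
Proof. by rewrite -i1 alphai. Qed.

Let xij x : xi (j x) = x.
Proof. by rewrite /xi -jV betaj invgK. Qed.

Let xii a : xi (i a) = 1.
Proof. by rewrite /xi -iV betai invg1. Qed.

Let xi_l x b : xi (j x ∘ b) = x ∘ xi b.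
Proof. by rewrite /xi invgM -jV beta_r invgM invgK. Qed.

Let xi_r b a : xi (b ∘ i a) = xi b.
Proof. by rewrite /xi invgM -iV beta_l. Qed.

Let factor_xi b : b = j (xi b) ∘ i (alpha b^-1)^-1.
Proof. by rewrite /xi iV jV -invgM -factor invgK. Qed.

(** Expanding [j x ∘ (i a ⋅ i b)] gives the product of [sg x a] and
    [sg x (1 ⋅ b)]; the left factor 1 under [sg x] is then absorbed by
    [compat]. *)
Let sg_dot x : {morph sg x : a b / a ⋅ b}.
Proof.
move=> a b; rewrite {1}/sg iD circ_dotE alphaD -/(sg x a).
rewrite -dot_one_dot -[RHS]dot_one_dot; congr (_ ⋅ _).
have <- : sg x (1 ⋅ b) = alpha (lambda (j x) (i b)).
  rewrite /lambda (factor ((j x)^-1 ⋅ i b)) alphaD -jV alphaj alphai.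
  by rewrite mulgA alpha_r.
have one_alpha c : 1 ⋅ alpha c = alpha (1 ⋅ c) by rewrite alphaD alpha1.
by rewrite /sg !one_alpha iD i1 -compat.
Qed.

Let dlE a x : (dl a x^-1)^-1 = xi ((i a)^-1 ∘ j x).
Proof. by rewrite /xi invgM invgK /dl jV. Qed.

(** The same argument as for [sg_dot], applied to left translation by
    [(i a)^-1] followed by the projection [xi]. *)
Let dl_dot a x y :
  (dl a (x ⋅ y)^-1)^-1 = (dl a x^-1)^-1 ⋅ (dl a y^-1)^-1.
Proof.
rewrite !dlE jD circ_dotE xiD.
rewrite -dot_one_dot -[RHS]dot_one_dot; congr (_ ⋅ _).
have -> : xi (lambda (i a)^-1 (j y)) = xi ((i a)^-1 ∘ j (1 ⋅ y)).
  rewrite /lambda invgK (factor_xi (i a ⋅ j y)) xiD xii xij.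
  by rewrite mulgA xi_r.
have one_xi c : 1 ⋅ xi c = xi (1 ⋅ c) by rewrite xiD -j1 xij.
by rewrite !one_xi jD j1 -compat.
Qed.

Let dl_xi b : dl (alpha b) (xi b)^-1 = (beta b)^-1.
Proof.
have ai : i (alpha b) = b ∘ j (beta b)^-1 by rewrite {2}(factor b) jV mulgK.
rewrite /dl ai mulgA beta_r.
by rewrite {2}(factor_xi b) mulgA -jM mulVg j1 mul1g betai mul1g.
Qed.

Let sg_xi b : sg (xi b)^-1 (alpha b) = (alpha b^-1)^-1.
Proof.
have ai : i (alpha b) = b ∘ j (beta b)^-1 by rewrite {2}(factor b) jV mulgK.
rewrite /sg ai mulgA alpha_r.
by rewrite {2}(factor_xi b) mulgA -jM mulVg j1 mul1g alphai.
Qed.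

(** The isomorphism is [b |-> (alpha b, xi b)]: it sends
    [i a ∘ j s = j x ∘ i c] to [(a, x)], pairing the A-first factor with the
    S-first one, because these are the two projections multiplicative
    for ⋅. *)
Lemma internal_matched_product :
  exists m : matched_pair A S, isomorphic B (matched_product m).
Proof.
pose m := MatchedPair dl_bij dl_act sg_bij sg_dot sg_act sg_circ sg1 dl_circ
  dl1 dl_dot.
exists m, (fun b => (alpha b, xi b)); split.
- exists (fun p : A * S => i p.1 ∘ j (dl p.1 p.2^-1)^-1) => [b|[a x]] /=.
    by rewrite dl_xi invgK -factor.
  rewrite alphaK; congr (_, _); rewrite jV.
  have -> : i a ∘ (j (dl a x^-1))^-1 = j x ∘ i (sg x^-1 a).
    by apply: (mulgI (j x)^-1); rewrite mulKg mulgA -jV swap mulgK.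
  by rewrite xi_r xij.
- by move=> b c; rewrite alphaD xiD.
move=> b c; rewrite [RHS](_ : _ =
  (alpha b ∘ sg (dl (alpha b) (xi b)^-1)^-1 (alpha c),
   xi b ∘ (dl (sg (xi b)^-1 (alpha b))^-1 (xi c)^-1)^-1)) //.
rewrite dl_xi sg_xi dlE !invgK; congr (_, _).
  rewrite {1}(factor b) -mulgA alpha_l; congr (_ ∘ _).
  by rewrite {1}(factor c) mulgA alpha_r.
rewrite {1}(factor_xi b) -mulgA xi_l; congr (_ ∘ _).
by rewrite {1}(factor_xi c) mulgA xi_r iV.
Qed.

End Internal.

(** * The sub-semi-braces 1B1, B1, E(B1), E(1B) and E(B) *)

Section OneDot.
Variable B : leftSemiBraceType.
Implicit Types a b c : B.

(** On 1B, the action of an element of E(1B) is left ∘-translation, because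
    elements of E(1B) are left ⋅-identities for 1B. *)
Lemma lambda_orbit1 a c : lambda (orbit1 a) c = orbit1 a ∘ (1 ⋅ c).
Proof. by rewrite -dot_lambda orbit1_dotl one_lambda. Qed.

Lemma left_subsemibraceI (A : set B) : A 1 ->
    (forall a b, A a -> A b -> A (a ⋅ b)) ->
    (forall a b, A a -> A b -> A (a ∘ b^-1)) ->
  left_subsemibrace A.
Proof.
move=> A1 AD AM; split=> [a b|]; first by rewrite !in_setE; apply: AD.
by split=> [|a b]; rewrite !in_setE //; apply: AM.
Qed.

End OneDot.

Section Compatible.
Variable B : leftSemiBraceType.
Hypothesis compat : one_compatible B.
Implicit Types a b c : B.

Lemma one_dot_circ a b : 1 ⋅ a = a -> 1 ⋅ (a ∘ b) = a ∘ (1 ⋅ b).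
Proof. by move=> a1; rewrite compat -dot_lambda dotA a1. Qed.

Lemma one_dotV a : 1 ⋅ a = a -> 1 ⋅ a^-1 = a^-1.
Proof.
move=> a1; apply: (mulgI a).
by rewrite -one_dot_circ // mulgV one_dot_one.
Qed.

Lemma one_dot_circ1 a b : 1 ⋅ b = 1 -> 1 ⋅ (a ∘ b) = 1 ⋅ a.
Proof. by move=> b1; rewrite compat b1 mulg1. Qed.

Lemma one_dotV1 a : 1 ⋅ a = 1 -> 1 ⋅ a^-1 = 1.
Proof. by move=> a1; rewrite -(one_dot_circ1 a^-1 a1) mulVg one_dot_one. Qed.

(** An element a of E(1B) acts on 1B by left ∘-translation, so it sends a^-1,
    which is in 1B, to 1; thus a^-1 sends 1 to a^-1. *)
Lemma orbit1_invg a : orbit1 a = a -> orbit1 a^-1 = a^-1.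
Proof.
move=> aE; have a1 : 1 ⋅ a = a by rewrite -[in LHS]aE one_orbit1.
have aVK : lambda a a^-1 = 1.
  by rewrite -{1}aE lambda_orbit1 aE one_dotV // mulgV.
by rewrite /orbit1 -aVK lambdaKV one_dotV.
Qed.

Lemma left_subsemibrace_one_dot_B_dot_one :
  left_subsemibrace (one_dot_B_dot_one B).
Proof.
apply: left_subsemibraceI => [|a b|a b] /=; rewrite ?one_dot_B_dot_oneP.
- by rewrite one_dot_one orbit1_1.
- by move=> [a1 a2] [b1 b2]; rewrite dotA a1 orbit1_dot.
move=> [a1 a2] [b1 /orbit1V b2].
by rewrite one_dot_circ // one_dotV // orbit1_circ b2.
Qed.

Lemma left_subsemibrace_B_dot_one : left_subsemibrace (B_dot_one B).
Proof.
apply: left_subsemibraceI => [|a b|a b]; rewrite ?B_dot_oneP.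
- by rewrite orbit1_1.
- by move=> _; rewrite orbit1_dot.
by move=> a1 /orbit1V b1; rewrite orbit1_circ b1.
Qed.

Lemma left_subsemibrace_idempotents_B_dot_one :
  left_subsemibrace (idempotents (B_dot_one B)).
Proof.
apply: left_subsemibraceI => [|a b|a b]; rewrite ?idempotents_B_dot_oneP.
- by rewrite one_dot_one orbit1_1.
- by move=> [a1 a2] [b1 b2]; rewrite dotA a2 orbit1_dot.
move=> [a1 a2] [/orbit1V b1 b2].
by rewrite orbit1_circ b1 one_dot_circ1 // one_dotV1.
Qed.

Lemma left_subsemibrace_idempotents_one_dot_B :
  left_subsemibrace (idempotents (one_dot_B B)).
Proof.
apply: left_subsemibraceI => [|a b|a b]; rewrite ?idempotents_one_dot_BP.
- by rewrite orbit1_1.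
- by move=> a1 b1; rewrite orbit1_dot -a1 orbit1_dotl -b1 one_orbit1 orbit1_id.
move=> a1 /orbit1_invg b1.
by rewrite orbit1_circ b1 -a1 lambda_orbit1 a1 -b1 one_orbit1.
Qed.

(** Stability under ∘ and ⋅ comes from [orbit1_dotl].  For inverses, split
    a in E(B) as [a = r ∘ k] with r = [orbit1 a] in E(1B) and k in E(B1): both of
    these sets are subgroups contained in E(B). *)
Lemma left_subsemibrace_idempotents : left_subsemibrace (idempotents [set: B]).
Proof.
have EM a b : orbit1 a = 1 ⋅ a -> orbit1 b = 1 ⋅ b ->
    orbit1 (a ∘ b) = 1 ⋅ (a ∘ b).
  move=> aE bE; rewrite orbit1_circ bE lambda_one compat -dot_lambda dotA -aE.
  by rewrite orbit1_dotl one_lambda.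
have EV a : orbit1 a = 1 ⋅ a -> orbit1 a^-1 = 1 ⋅ a^-1.
  move=> aE; set r := orbit1 a; have rE : orbit1 r = r by apply: orbit1_id.
  have -> : a^-1 = (r^-1 ∘ a)^-1 ∘ r^-1 by rewrite invgM invgK mulgK.
  apply: EM.
    have k1 : 1 ⋅ (r^-1 ∘ a) = 1 by rewrite compat -aE mulVg one_dot_one.
    rewrite one_dotV1 //; apply/orbit1V.
    by rewrite orbit1_circ -/r -{2}rE lambdaKV one_dot_one.
  by rewrite -orbit1_invg // one_orbit1 orbit1_id.
apply: left_subsemibraceI => [|a b|a b]; rewrite ?idempotentsP.
- by rewrite orbit1_1 one_dot_one.
- by move=> aE bE; rewrite orbit1_dot dotA -aE orbit1_dotl.
by move=> aE /EV; apply: EM.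
Qed.

(** * The two factorizations *)

Section Factorizations.
Let hG := left_subsemibrace_one_dot_B_dot_one.
Let hH := left_subsemibrace_B_dot_one.
Let hL := left_subsemibrace_idempotents_B_dot_one.

Lemma subsemibrace_one_compatible (A : set B) (hA : left_subsemibrace A) :
  one_compatible (subsemibrace hA).
Proof. by move=> a b; apply: val_inj; apply: compat. Qed.

Lemma one_dot_B_dot_one_in_B_dot_one (g : subsemibrace hG) :
  val g \in B_dot_one B.
Proof.
by have := valP g; rewrite !in_setE one_dot_B_dot_oneP B_dot_oneP => -[].
Qed.

Lemma idempotents_in_B_dot_one (l : subsemibrace hL) :
  val l \in B_dot_one B.
Proof.
by have := valP l; rewrite !in_setE idempotents_B_dot_oneP B_dot_oneP => -[].
Qed.

Lemma one_dot_in_one_dot_B_dot_one (h : subsemibrace hH) :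
  1 ⋅ val h \in one_dot_B_dot_one B.
Proof.
have := valP h; rewrite !in_setE one_dot_B_dot_oneP B_dot_oneP => h1.
by rewrite dot_one_dot orbit1_dot.
Qed.

Lemma one_dotV_circ_in_idempotents (h : subsemibrace hH) :
  (1 ⋅ val h)^-1 ∘ val h \in idempotents (B_dot_one B).
Proof.
have := valP h; rewrite !in_setE idempotents_B_dot_oneP B_dot_oneP => h1.
rewrite compat mulVg one_dot_one orbit1_circ h1; split=> //.
by apply/orbit1V; rewrite orbit1_dot.
Qed.

(** The exact factorization is [h = (1 ⋅ h) ∘ ((1 ⋅ h)^-1 ∘ h)], with first factor
    in 1B1 and second in E(B1). *)
Lemma B_dot_one_matched_product :
  exists m : matched_pair (subsemibrace hG) (subsemibrace hL),
    isomorphic (subsemibrace hH) (matched_product m).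
Proof.
apply: (@internal_matched_product _ _ _
  (fun g => SubSemiBrace hH (one_dot_B_dot_one_in_B_dot_one g))
  (fun l => SubSemiBrace hH (idempotents_in_B_dot_one l))
  (fun h => SubSemiBrace hG (one_dot_in_one_dot_B_dot_one h))
  (fun h => SubSemiBrace hL (one_dotV_circ_in_idempotents h))).
- by move=> a b; apply: val_inj.
- by move=> a b; apply: val_inj.
- by move=> a b; apply: val_inj.
- by move=> a b; apply: val_inj.
- by move=> h; apply: val_inj; rewrite /= mulVKg.
- move=> g l; apply: val_inj => /=.
  have := valP g; have := valP l; rewrite !in_setE idempotents_B_dot_oneP.
  rewrite one_dot_B_dot_oneP => -[l1 l2] [g1 g2].
  by rewrite one_dot_circ // l2 mulg1.
- move=> g l; apply: val_inj => /=.
  have := valP g; have := valP l; rewrite !in_setE idempotents_B_dot_oneP.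
  rewrite one_dot_B_dot_oneP => -[l1 l2] [g1 g2].
  by rewrite one_dot_circ // l2 mulg1 mulKg.
- by move=> a b; apply: val_inj; rewrite /= dot_one_dot dotA.
- move=> a b; apply: val_inj => /=.
  have xiE (c : B) : ((1 ⋅ c^-1)^-1 ∘ c^-1)^-1 = c ∘ (1 ⋅ c^-1).
    by rewrite invgM !invgK.
  have a1 : orbit1 (val a) = 1 by have := valP a; rewrite in_setE B_dot_oneP.
  (* E(B1) is a left-zero semigroup, so the claim is that
     c ∘ (1 ⋅ c^-1) takes the same value at a ⋅ b and at a. *)
  rewrite !xiE -[RHS]dot_one_dot.
  have -> (c : B) : 1 ⋅ (c ∘ (1 ⋅ c^-1)) = 1.
    by rewrite -compat mulgV one_dot_one.
  have -> : val a ∘ (1 ⋅ (val a)^-1) ⋅ 1 = val a ∘ (1 ⋅ (val a)^-1).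
    apply/dot1_fixed; rewrite orbit1_circ orbit1_dot.
    by rewrite (iffRL (orbit1V _) a1).
  rewrite (dot_circE (val a)) invgM -mulgA; congr (_ ∘ _).
  have c1 := one_lambda (val a)^-1 (val b).
  by rewrite one_dot_circ ?mulVKg; last exact: one_dotV.
exact: subsemibrace_one_compatible.
Qed.

Lemma dot1_in_B_dot_one b : b ⋅ 1 \in B_dot_one B.
Proof. by rewrite in_setE; exists b. Qed.

Let hR := left_subsemibrace_idempotents_one_dot_B.

Lemma orbit1_in_idempotents b : orbit1 b \in idempotents (one_dot_B B).
Proof. by rewrite in_setE idempotents_one_dot_BP orbit1_id. Qed.

(** The exact factorization of B is [b = (b ⋅ 1) ∘ (orbit1 b^-1)^-1], with first
    factor in B1 and second in E(1B); the first factor is carried to A along the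
    given isomorphism. *)
Lemma one_compatible_matched_product (A : leftSemiBraceType) :
  isomorphic (subsemibrace hH) A ->
  exists m : matched_pair A (subsemibrace hR), isomorphic B (matched_product m).
Proof.
move=> [phi [[psi phiK psiK] phiD phiM]].
have psiD : {morph psi : a b / a ⋅ b}.
  by move=> a b; rewrite -{1}(psiK a) -{1}(psiK b) -phiD phiK.
have psiM : {morph psi : a b / a ∘ b}.
  by move=> a b; rewrite -{1}(psiK a) -{1}(psiK b) -phiM phiK.
pose mkR b := SubSemiBrace hR (orbit1_in_idempotents b).
have HR (h : subsemibrace hH) (r : subsemibrace hR) :
    orbit1 (val h ∘ val r)^-1 = (val r)^-1.
  have := valP h; have := valP r; rewrite !in_setE.
  rewrite B_dot_oneP idempotents_one_dot_BP => rE /orbit1V hE.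
  by rewrite invgM orbit1_circ hE; exact: orbit1_invg.
apply: (@internal_matched_product A (subsemibrace hR) B
  (fun x => val (psi x)) (fun r => val r)
  (fun b => phi (SubSemiBrace hH (dot1_in_B_dot_one b)))
  (fun b => (mkR b^-1)^-1)).
- by move=> a b; rewrite psiM.
- by move=> a b; rewrite psiD.
- by [].
- by [].
- by move=> b; rewrite phiK /= dot1E mulgK.
- move=> a r; rewrite -[RHS]psiK; congr phi; apply: val_inj => /=.
  by rewrite dot1E HR mulgK.
- by move=> a r; apply: val_inj; rewrite /= HR invgK.
- move=> b c; rewrite -phiD; congr phi; apply: val_inj => /=.
  by rewrite -(dotA b 1) dot_one_dot dotA.
- move=> b c; apply: val_inj; rewrite /= !invgK.
  by rewrite orbit1_dot orbit1_dotl one_orbit1.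
exact: compat.
Qed.

End Factorizations.
End Compatible.

Theorem theorem3p3 (B : leftSemiBraceType) :
  rho_antihom B <->
  (exists (hG : left_subsemibrace (one_dot_B_dot_one B))
          (hL : left_subsemibrace (idempotents (B_dot_one B)))
          (hR : left_subsemibrace (idempotents (one_dot_B B)))
          (m1 : matched_pair (subsemibrace hG) (subsemibrace hL))
          (m2 : matched_pair (matched_product m1) (subsemibrace hR)),
     isomorphic B (matched_product m2)) /\
  left_subsemibrace (idempotents [set: B]).
Proof.
rewrite rho_antihomE; split=> [compat|[[hG [hL [hR [m1 [m2 iso]]]]] _]].
  split; last exact: left_subsemibrace_idempotents.
  have [m1 iso1] := B_dot_one_matched_product compat.
  have [m2 iso2] := one_compatible_matched_product compat iso1.
  by exists (left_subsemibrace_one_dot_B_dot_one compat),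
    (left_subsemibrace_idempotents_B_dot_one compat),
    (left_subsemibrace_idempotents_one_dot_B compat), m1, m2.
apply: (isomorphic_one_compatible iso).
apply: matched_product_one_compatible; first apply: matched_product_one_compatible.
- move=> a b; have := valP b; rewrite in_setE one_dot_B_dot_oneP => -[b1 _].
  by apply: val_inj; rewrite /= b1.
- have one_dotL (c : subsemibrace hL) : 1 ⋅ c = 1.
    apply: val_inj => /=.
    by have := valP c; rewrite in_setE idempotents_B_dot_oneP => -[].
  by move=> a b; rewrite !one_dotL.
move=> a b; have := valP b; rewrite in_setE idempotents_one_dot_BP => bE.
by apply: val_inj; rewrite /= -bE one_orbit1.
Qed.
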